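(* Let $(X,d)$ be a compact metric space of finite covering dimension, $f_{0,\infty}=\{f_n\}_{n=0}^\infty$ a sequence of continuous self-maps of $X$, and $\mu$ a Borel probability measure on $X$ that is $f_{0,\infty}$-invariant. Then for any $A\in\mathcal{S}$, $h_{A}(f_{0,\infty})\geq h_{A,\mu}(f_{0,\infty})$.
   Context: $f_i^n=f_{i+n-1}\circ\cdots\circ f_i$, $f_i^0=\mathrm{id}$, $f_i^{-n}(B)=(f_i^n)^{-1}(B)$. $\mathcal S$ is the set of strictly increasing sequences $A=\{a_i\}_{i\ge1}$ of nonnegative integers. Topological sequence entropy: $h_A(f_{0,\infty})=\sup_{\mathscr A}\limsup_{n\to\infty}\frac1n\log\mathcal N(\bigvee_{i=1}^n f_0^{-a_i}\mathscr A)$ over finite open covers $\mathscr A$, where $\bigvee$ denotes common refinement, $f_0^{-a}\mathscr A=\{f_0^{-a}U:U\in\mathscr A\}$, $\mathcal N$ the minimal cardinality of a subcover, and $\log$ the natural logarithm. $\mu$ is $f_{0,\infty}$-invariant if $\mu(f_n^{-1}B)=\mu(B)$ for all Borel $B$ and $n\ge0$. Measure-theoretic sequence entropy: for a finite Borel partition $\xi$, $h_{A,\mu}(f_{0,\infty},\xi)=\limsup_{n\to\infty}\frac1nH_\mu(\bigvee_{i=1}^n f_0^{-a_i}\xi)$ with $H_\mu(\eta)=-\sum_{C\in\eta}\mu(C)\ln\mu(C)$, and $h_{A,\mu}(f_{0,\infty})=\sup_\xi h_{A,\mu}(f_{0,\infty},\xi)$ over finite Borel partitions. *)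

(* Defs.v *)
From HB Require Import structures.
From mathcomp Require Import all_boot all_order all_algebra.
From mathcomp Require Import all_classical all_reals all_analysis.
Set Implicit Arguments. Unset Strict Implicit. Unset Printing Implicit Defensive.
Import Order.TTheory GRing.Theory Num.Theory.
Local Open Scope classical_set_scope.
Local Open Scope ring_scope.

Section SeqEntropy.
Context {R : realType} {X : pseudoPMetricType R}.

Fixpoint fiter (f : nat -> X -> X) (i n : nat) (x : X) : X :=
  match n with
  | 0 => x
  | n'.+1 => f (i + n')%N (fiter f i n' x)
  end.

Definition covering_dim_le (m : nat) : Prop :=
  forall (k : nat) (U : 'I_k -> set X),
    (forall i, open (U i)) -> (forall x : X, exists i, U i x) ->
    exists (l : nat) (V : 'I_l -> set X),
      [/\ (forall j, open (V j)),
          (forall x : X, exists j, V j x),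
          (forall j, exists i, V j `<=` U i) &
          (forall x : X, (#|[set j | `[< V j x >] ]| <= m.+1)%N)].

Definition finite_covering_dim : Prop := exists m, covering_dim_le m.

(* The common refinement  \/_{i=1}^n f_0^{-a_i} F  of a finite family
   F : 'I_k -> set X, indexed by the choice functions w : 'I_n -> 'I_k;
   the sequence A = {a_1 < a_2 < ...} is represented by a : nat -> nat with
   a_{i+1} = a i. *)
Definition join_fam (f : nat -> X -> X) (a : nat -> nat) (k n : nat)
    (F : 'I_k -> set X) : {ffun 'I_n -> 'I_k} -> set X :=
  fun w => [set x | forall i : 'I_n, F (w i) (fiter f 0 (a i) x)].

Definition Ncov (I : finType) (U : I -> set X) : nat :=
  xget 0%N [set m | (exists J : {set I}, (forall x, exists2 j, j \in J & U j x)
                                        /\ #|J| = m)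
                    /\ (forall J : {set I}, (forall x, exists2 j, j \in J & U j x)
                                        -> (m <= #|J|)%N)].

Definition open_cover (k : nat) (U : 'I_k -> set X) : Prop :=
  (forall i, open (U i)) /\ (forall x : X, exists i, U i x).

Definition htop_cover (f : nat -> X -> X) (a : nat -> nat) (k : nat)
    (U : 'I_k -> set X) : \bar R :=
  limn_esup (fun n => ((ln (Ncov (@join_fam f a k n U))%:R) / n%:R)%:E).

Definition htop (f : nat -> X -> X) (a : nat -> nat) : \bar R :=
  ereal_sup [set e | exists (k : nat) (U : 'I_k -> set X),
                    open_cover U /\ e = htop_cover f a U].

End SeqEntropy.

Section MeasEntropy.
Context {R : realType} {X : pseudoPMetricType R}.

Definition borel_type := g_sigma_algebraType (@open X).

Definition borel_partition (k : nat) (xi : 'I_k -> set X) : Prop :=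
  [/\ (forall i, measurable (xi i : set borel_type)),
      (forall i j, i != j -> xi i `&` xi j = set0) &
      (forall x : X, exists i, xi i x)].

Definition Hmu (mu : set borel_type -> \bar R) (I : finType) (eta : I -> set X) : R :=
  - \sum_(i : I) (fine (mu (eta i)) * ln (fine (mu (eta i)))).

Definition hmu_part (mu : set borel_type -> \bar R) (f : nat -> X -> X)
    (a : nat -> nat) (k : nat) (xi : 'I_k -> set X) : \bar R :=
  limn_esup (fun n => (Hmu mu (@join_fam _ _ f a k n xi) / n%:R)%:E).

Definition hmu (mu : set borel_type -> \bar R) (f : nat -> X -> X)
    (a : nat -> nat) : \bar R :=
  ereal_sup [set e | exists (k : nat) (xi : 'I_k -> set X),
                    borel_partition xi /\ e = hmu_part mu f a xi].

End MeasEntropy.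

(* Main.v *)
Require Import Defs.
From HB Require Import structures.
From mathcomp Require Import all_boot all_order all_algebra.
From mathcomp Require Import all_classical all_reals all_analysis.
From mathcomp Require Import ring lra.
Set Implicit Arguments. Unset Strict Implicit. Unset Printing Implicit Defensive.
Import Order.TTheory GRing.Theory Num.Theory.
Local Open Scope classical_set_scope.
Local Open Scope ring_scope.

(** Given a partition xi = (A_j) and e > 0, regularity of mu provides closed
    sets B_j in A_j with mu (A_j \ B_j) <= e^2, hence the open cover
    U_i = X \ \bigcup_(j != i) B_j.  Choose measurably, for every x, an element
    w(x) of a minimal subcover of the n-th join of U containing x, and let z(y)
    be None when y lies in some B_j and Some j when y lies in A_j \ B_j.  Then
    w(x) and the values of z along the orbit of x determine the xi-name of x:
    at a time with z = None the point lies in B_j and in U_(w_i), which forces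
    j = w_i.  Since mu is invariant, all these copies of z have the same law, so
    subadditivity of entropy gives H(join xi) <= ln N(join U) + n H(z), and
    H(z) tends to 0 with e because z = None outside a set of small measure. *)

(** * Entropy of finite families of nonnegative reals *)

Definition entropy (R : realType) (K : finType) (p : K -> R) : R :=
  - \sum_t p t * ln (p t).

Lemma ln_le_subr1 (R : realType) (x : R) : 0 < x -> ln x <= x - 1.
Proof.
move=> x0; have -> : ln x = ln (1 + (x - 1)) by congr ln; ring.
by apply: le_ln1Dx; lra.
Qed.

Lemma ln_prod (R : realType) (I : finType) (x : I -> R) :
  (forall i, 0 < x i) -> ln (\prod_i x i) = \sum_i ln (x i).
Proof.
move=> x0; apply: (@expR_inj R); rewrite expR_sum lnK ?posrE ?prodr_gt0//.
by apply: eq_bigr => i _; rewrite lnK// posrE.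
Qed.

(** The bound [ln x <= x - 1] at [x = q t / p t], weighted by [p t], compares each term with
    [q t - p t], and these differences sum to at most 0. Positivity of [q t] where [p t] is positive
    guards against the convention that [ln] is 0 at 0. *)
Lemma gibbs (R : realType) (K : finType) (p q : K -> R) :
  (forall t, 0 <= p t) -> (forall t, 0 <= q t) ->
  (forall t, 0 < p t -> 0 < q t) -> \sum_t q t <= \sum_t p t ->
  entropy p <= - \sum_t p t * ln (q t).
Proof.
move=> p0 q0 pq qp; rewrite lerN2 -subr_le0 -sumrB.
rewrite (le_trans (y := \sum_t (q t - p t)))//; last by rewrite sumrB subr_le0.
apply: ler_sum => t _; have := p0 t; rewrite le_eqVlt => /predU1P[<-|pt].
  by rewrite !mul0r !subr0.
rewrite -mulrBr -ln_div ?posrE ?pq//.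
have := ln_le_subr1 (divr_gt0 (pq _ pt) pt).
move=> /(ler_wpM2l (ltW pt)) /le_trans; apply.
by rewrite mulrBr mulr1 mulrCA divff ?gt_eqF// mulr1.
Qed.

(** Merging atoms lowers entropy: each mass is at most that of its fibre under [h], and [ln] is
    monotone. *)
Lemma entropy_pushforward (R : realType) (K L : finType) (h : K -> L)
    (p : K -> R) : (forall t, 0 <= p t) ->
  entropy (fun s => \sum_(t | h t == s) p t) <= entropy p.
Proof.
move=> p0; rewrite lerN2 (partition_big h predT)//=; apply: ler_sum => s _.
rewrite mulr_suml; apply: ler_sum => t /eqP hts.
have := p0 t; rewrite le_eqVlt => /predU1P[<-|pt]; first by rewrite !mul0r.
have ple : p t <= \sum_(t | h t == s) p t.
  by rewrite (bigD1 t) ?hts//= lerDl sumr_ge0.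
by rewrite ler_pM2l// ler_ln// posrE (lt_le_trans pt).
Qed.

(** With [s] the square root of [x], the left side is [- 2 * s ^+ 2 * ln s], and
    [- ln s <= s^-1 - 1] bounds it by [2 * s - 2 * s ^+ 2]. *)
Lemma Nxlnx_le_sqrt (R : realType) (x : R) : 0 <= x ->
  - (x * ln x) <= 2 * Num.sqrt x.
Proof.
rewrite le_eqVlt => /predU1P[<-|x0].
  by rewrite mul0r oppr0 mulr_ge0// sqrtr_ge0.
have s0 : 0 < Num.sqrt x by rewrite sqrtr_gt0.
have xE : x = Num.sqrt x ^+ 2 by rewrite sqr_sqrtr// ltW.
set s := Num.sqrt x in s0 xE *; rewrite xE lnXn// mulr2n.
have : - ln s <= s^-1 - 1.
  by rewrite -lnV ?posrE//; apply: ln_le_subr1; rewrite invr_gt0.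
move=> /(ler_wpM2l (ltW (exprn_gt0 2 s0))).
rewrite mulrBr {2}expr2 -[X in _ <= X - _]mulrA divff ?gt_eqF// mulr1.
by have := exprn_gt0 2 s0; lra.
Qed.

(** An atom other than [t0] has mass at most [e ^+ 2], so the square-root bound gives it entropy at
    most [2 * e]. The atom [t0] contributes at most [1 - q t0], the mass of all the others, which is
    at most [#|K| * e] since [e <= 1]. *)
Lemma entropy_concentrated (R : realType) (K : finType) (q : K -> R) (t0 : K)
    (e : R) : (forall t, 0 <= q t) -> \sum_t q t = 1 -> 0 <= e <= 1 ->
    (forall t, t != t0 -> q t <= e ^+ 2) ->
  entropy q <= 3 * #|K|%:R * e.
Proof.
move=> q0 q1 /andP[e0 e1] qe.
have cst (c : R) : 0 <= c -> \sum_(t | t != t0) c <= #|K|%:R * c.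
  by move=> c0; rewrite sumr_const -[leLHS]mulr_natl; apply: ler_wpM2r; rewrite // ler_nat max_card.
have rest : - \sum_(t | t != t0) q t * ln (q t) <= #|K|%:R * (2 * e).
  rewrite -sumrN; apply: le_trans (cst _ _); last by rewrite mulr_ge0.
  apply: ler_sum => t tt0; apply: le_trans (Nxlnx_le_sqrt (q0 t)) _.
  by rewrite ler_pM2l// -(ger0_norm e0) -sqrtr_sqr ler_wsqrtr// qe.
have main : - (q t0 * ln (q t0)) <= #|K|%:R * e.
  apply: (le_trans (y := 1 - q t0)).
    have := q0 t0; rewrite le_eqVlt => /predU1P[<-|qt].
      by rewrite mul0r; lra.
    have : - ln (q t0) <= (q t0)^-1 - 1.
      by rewrite -lnV ?posrE//; apply: ln_le_subr1; rewrite invr_gt0.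
    move=> /(ler_wpM2l (ltW qt)).
    by rewrite mulrBr divff ?gt_eqF// mulrN mulr1.
  rewrite -[X in X - _]q1 (bigD1 t0)//= addrAC subrr add0r.
  apply: le_trans (cst _ e0).
  apply: ler_sum => t tt0; apply: le_trans (qe t tt0) _.
  by rewrite expr2 ler_piMl.
rewrite /entropy (bigD1 t0)//= opprD.
apply: le_trans (lerD main rest) _.
by rewrite le_eqVlt; apply/orP; left; apply/eqP; ring.
Qed.

(** * Measurable maps into finite sets and their laws *)

(** Quantifying over all subsets of [K] spares a sigma-algebra on [K] and makes composition with any
    map out of [K] harmless. *)
Definition fin_measurable d (T : measurableType d) (K : Type) (g : T -> K) :=
  forall S : set K, measurable (g @^-1` S).

Lemma fin_measurable_fibers d (T : measurableType d) (K : finType)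
    (g : T -> K) : (forall t, measurable (g @^-1` [set t])) -> fin_measurable g.
Proof.
move=> mg S; have -> : g @^-1` S = \bigcup_(t in S) g @^-1` [set t].
  by apply/seteqP; split => [x Sx|x [t St] /= -> //]; exists (g x).
by apply: fin_bigcup_measurable => // t _; exact: mg.
Qed.

Lemma fin_measurable_comp d (T : measurableType d) (K L : Type) (g : T -> K)
    (h : K -> L) : fin_measurable g -> fin_measurable (h \o g).
Proof. by move=> mg S; exact: (mg (h @^-1` S)). Qed.

Lemma fin_measurable_pair d (T : measurableType d) (K L : finType)
    (g : T -> K) (h : T -> L) : fin_measurable g -> fin_measurable h ->
  fin_measurable (fun x => (g x, h x)).
Proof.
move=> mg mh; apply: fin_measurable_fibers => -[s t].
have -> : (fun x => (g x, h x)) @^-1` [set (s, t)] =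
    g @^-1` [set s] `&` h @^-1` [set t].
  by apply/seteqP; split => x /= [-> ->].
exact: measurableI.
Qed.

Lemma fin_measurable_ffun d (T : measurableType d) (I K : finType)
    (g : I -> T -> K) : (forall i, fin_measurable (g i)) ->
  fin_measurable (fun x => [ffun i => g i x]).
Proof.
move=> mg; apply: fin_measurable_fibers => t.
have -> : (fun x => [ffun i => g i x]) @^-1` [set t] =
    \bigcap_(i in [set: I]) g i @^-1` [set t i].
  apply/seteqP; split => x /= => [<- i _ /=|xt]; first by rewrite ffunE.
  by apply/ffunP => i; rewrite ffunE xt.
by apply: fin_bigcap_measurable => // i _; exact: mg.
Qed.

Lemma fin_measurable_asbool d (T : measurableType d) (E : set T) :
  measurable E -> fin_measurable (fun x => `[< E x >]).
Proof.
move=> mE; apply: fin_measurable_fibers => -[].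
  have -> : (fun x => `[< E x >]) @^-1` [set true] = E.
    by apply/seteqP; split => x /= /asboolP.
  exact: mE.
have -> : (fun x => `[< E x >]) @^-1` [set false] = ~` E.
  by apply/seteqP; split => x /=; case: asboolP.
exact: measurableC.
Qed.

Definition law d (T : measurableType d) (R : realType) (mu : set T -> \bar R)
  (K : Type) (g : T -> K) (t : K) : R := fine (mu (g @^-1` [set t])).

Lemma fine_measure_preimage d (T : measurableType d) (R : realType)
    (mu : probability T R) (K : finType) (g : T -> K) (P : pred K) :
  fin_measurable g ->
  fine (mu (g @^-1` [set t | P t])) = \sum_(t | P t) law mu g t.
Proof.
move=> mg; have -> : g @^-1` [set t | P t] =
    \bigcup_(t in [set` enum P]) g @^-1` [set t].
  apply/seteqP; split => [x Px|x [t]] /=; last first.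
    by rewrite mem_enum => Pt ->.
  by exists (g x) => //=; rewrite mem_enum.
rewrite measure_fin_bigcup//; last exact: trivIset_preimage1.
rewrite -fsbig_seq ?enum_uniq// -sum_fine ?big_enum// => t _.
exact: fin_num_measure.
Qed.

Lemma law_ge0 d (T : measurableType d) (R : realType)
    (mu : probability T R) (K : Type) (g : T -> K) (t : K) : 0 <= law mu g t.
Proof. exact: fine_ge0. Qed.

Lemma sum_law d (T : measurableType d) (R : realType)
    (mu : probability T R) (K : finType) (g : T -> K) :
  fin_measurable g -> \sum_t law mu g t = 1.
Proof.
move=> mg; rewrite -(fine_measure_preimage mu predT mg).
have -> : g @^-1` [set t | predT t] = setT by apply/seteqP; split.
by rewrite probability_setT.
Qed.

Lemma law_comp d (T : measurableType d) (R : realType)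
    (mu : probability T R) (K L : finType) (g : T -> K) (h : K -> L) (s : L) :
  fin_measurable g -> law mu (h \o g) s = \sum_(t | h t == s) law mu g t.
Proof.
move=> mg; rewrite -fine_measure_preimage//; congr (fine (mu _)).
by apply/seteqP; split => x /= /eqP.
Qed.

Lemma sum_law_comp d (T : measurableType d) (R : realType)
    (mu : probability T R) (K L : finType) (g : T -> K) (h : K -> L)
    (F : L -> R) : fin_measurable g ->
  \sum_t law mu g t * F (h t) = \sum_s law mu (h \o g) s * F s.
Proof.
move=> mg; rewrite (partition_big h predT)//=; apply: eq_bigr => s _.
by rewrite law_comp// mulr_suml; apply: eq_bigr => t /eqP ->.
Qed.

Lemma entropy_law_comp d (T : measurableType d) (R : realType)
    (mu : probability T R) (K L : finType) (g : T -> K) (h : K -> L) :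
  fin_measurable g -> entropy (law mu (h \o g)) <= entropy (law mu g).
Proof.
move=> mg; apply: le_trans (entropy_pushforward h (law_ge0 mu g)).
by rewrite /entropy lerN2; apply: ler_sum => s _; rewrite law_comp.
Qed.

(** Coding by [psi] cannot raise entropy, so it suffices to bound the joint law of [w] and the
    [z i]. No independence is assumed: the cross-entropy against a product law depends only on the
    marginals. *)
Lemma entropy_law_code d (T : measurableType d) (R : realType)
    (mu : probability T R) (n : nat) (W K C : finType) (J : {set W})
    (w : T -> W) (z : 'I_n -> T -> K) (q : K -> R)
    (psi : W -> {ffun 'I_n -> K} -> C) :
  fin_measurable w -> (forall i, fin_measurable (z i)) ->
  (forall x, w x \in J) -> (forall i t, law mu (z i) t = q t) ->
  entropy (law mu (fun x => psi (w x) [ffun i => z i x])) <=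
    ln #|J|%:R + n%:R * entropy q.
Proof.
move=> mw mz wJ zq.
pose g x : W * {ffun 'I_n -> K} := (w x, [ffun i => z i x]).
have mg : fin_measurable g.
  by apply: fin_measurable_pair => //; exact: fin_measurable_ffun.
apply: le_trans (entropy_law_comp mu (fun u => psi u.1 u.2) mg) _.
(* The space is pointed, so [J] contains at least one value of [w]. *)
have J0 : (0 : R) < #|J|%:R.
  by rewrite ltr0n; apply/card_gt0P; exists (w point).
(* Gibbs' inequality against the law under which w is uniform on J and
   independent of the independent z_i. *)
pose Q (u : W * {ffun 'I_n -> K}) : R :=
  (u.1 \in J)%:R / #|J|%:R * \prod_i law mu (z i) (u.2 i).
have Q0 u : 0 <= Q u.
  by rewrite mulr_ge0 ?divr_ge0 ?ler0n// prodr_ge0// => i _; exact: law_ge0.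
(* Positivity for Gibbs: [w] takes values in [J], and a joint mass is at most each of its marginal
   masses. *)
have gJ u : 0 < law mu g u -> u.1 \in J.
  move=> gu; apply: contraT => uJ; move: gu.
  rewrite /law (_ : g @^-1` [set u] = set0) ?measure0 ?ltxx//.
  by apply/seteqP; split => x //= gxu; move: uJ; rewrite -gxu wJ.
have gz u i : 0 < law mu g u -> 0 < law mu (z i) (u.2 i).
  move=> /lt_le_trans; apply.
  have -> : law mu (z i) = law mu ((fun u : W * {ffun 'I_n -> K} => u.2 i) \o g).
    by congr law; apply/funext => x; rewrite /= ffunE.
  by rewrite law_comp// (bigD1 u)//= lerDl sumr_ge0// => *; exact: law_ge0.
have gQ u : 0 < law mu g u -> 0 < Q u.
  move=> gu; rewrite mulr_gt0 ?divr_gt0 ?gJ//.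
  by apply: prodr_gt0 => i _; exact: gz.
have Q1 : \sum_u Q u = 1.
  rewrite -(pair_bigA _ (fun v y => Q (v, y)))/= /Q/=.
  have zsum1 : \sum_(y : {ffun 'I_n -> K}) \prod_i law mu (z i) (y i) = 1.
    rewrite -(bigA_distr_bigA (fun i t => law mu (z i) t)) big1 => // i _.
    exact: sum_law.
  under eq_bigr do rewrite -mulr_sumr zsum1 mulr1.
  rewrite -mulr_suml -natr_sum -big_mkcond/= sum1_card.
  by rewrite divff// gt_eqF.
apply: le_trans (gibbs (law_ge0 mu g) Q0 gQ _) _.
  by rewrite Q1 sum_law.
(* The logarithm of the product is expanded only where the joint mass, hence every factor, is
   positive; elsewhere both sides are 0. *)
have lnQ u : law mu g u * ln (Q u) = - (law mu g u * ln #|J|%:R) +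
    \sum_i law mu g u * ln (law mu (z i) (u.2 i)).
  have := law_ge0 mu g u; rewrite le_eqVlt => /predU1P[<-|gu].
    by rewrite !mul0r oppr0 add0r big1// => i _; rewrite mul0r.
  rewrite -mulr_sumr -mulrN -mulrDr; congr (_ * _).
  rewrite /Q gJ// div1r lnM ?posrE ?invr_gt0//; last first.
    by apply: prodr_gt0 => i _; exact: gz.
  rewrite lnV ?posrE//; congr (_ + _).
  by apply: ln_prod => i; exact: gz.
under eq_bigr do rewrite lnQ.
rewrite big_split/= sumrN -mulr_suml sum_law// mul1r opprD opprK lerD2l.
(* For fixed [i] the summand's logarithm depends on [u] only through [u.2 i], so the sum over [u]
   reduces to one against the marginal [q], namely [- entropy q]. *)
rewrite exchange_big/=.
rewrite le_eqVlt; apply/orP; left; apply/eqP.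
under eq_bigr => i _.
  rewrite (@sum_law_comp _ _ _ mu _ _ g (fun u : W * {ffun 'I_n -> K} => u.2 i)
    (fun t => ln (law mu (z i) t)))//.
  have -> : law mu ((fun u : W * {ffun 'I_n -> K} => u.2 i) \o g) = q.
    by apply/funext => t; rewrite -(zq i); congr law; apply/funext => x;
       rewrite /= ffunE.
  under eq_bigr do rewrite zq.
  over.
by rewrite sumr_const card_ord mulr_natl /entropy mulNrn.
Qed.

(** * Regularity of Borel probability measures *)

Lemma nonincreasing_measure_lt d (T : measurableType d) (R : realType)
    (mu : probability T R) (F : (set T)^nat) (e : \bar R) :
  (forall n, measurable (F n)) -> nonincreasing_seq F ->
  (mu (\bigcap_n F n) < e)%E -> exists n, (mu (F n) < e)%E.
Proof.
move=> mF niF Fe; apply: contrapT => /forallNP Fge.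
have cF : mu \o F @ \oo --> mu (\bigcap_n F n).
  apply: nonincreasing_cvg_mu => //; last exact: bigcapT_measurable.
  by rewrite (le_lt_trans (probability_le1 mu (mF 0%N)))// ltry.
move: Fe; apply/negP; rewrite -leNgt.
rewrite -(cvg_lim _ cF)//; apply: lime_ge.
  by apply/cvg_ex; eexists; exact: cF.
by apply: nearW => n; rewrite leNgt; apply/negP/Fge.
Qed.

Lemma open_borel_measurable (R : realType) (X : pseudoPMetricType R)
  (O : set (@borel_type R X)) : open (O : set X) -> measurable O.
Proof. exact: sub_sigma_algebra. Qed.

Lemma closed_borel_measurable (R : realType) (X : pseudoPMetricType R)
  (C : set (@borel_type R X)) : closed (C : set X) -> measurable C.
Proof.
move=> cC; rewrite -(setCK C); apply: measurableC.
by apply: open_borel_measurable; exact: closed_openC.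
Qed.

(** The closed set is the complement of a small open neighbourhood [G n] of the complement of [O].
    The sets [O]&[G n] decrease to the empty set, because each point of [O] has a ball inside
    [O]. *)
Lemma open_closed_approx (R : realType) (X : pseudoPMetricType R)
    (mu : probability (@borel_type R X) R) (O : set X) (e : R) :
  open O -> 0 < e ->
  exists C : set X, [/\ closed C, C `<=` O & (mu (O `\` C) < e%:E)%E].
Proof.
move=> oO e0.
(* Balls of a pseudometric type need not be open, hence the interiors. *)
pose G n : set X := \bigcup_(y in ~` O) (ball y (n.+1%:R^-1 : R))^°.
have oG n : open (G n) by apply: bigcup_open => y _; exact: open_interior.
have OG n : O `\` ~` G n = O `&` G n by rewrite setDE setCK.
have [|||n nlt] := @nonincreasing_measure_lt _ _ _ mu
    (fun n => O `&` G n) e%:E.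
- by move=> n; apply: open_borel_measurable; exact: openI.
- move=> m n mn; apply/subsetPset; apply: setIS => x [y Oy yx]; exists y => //.
  apply: interiorS yx; apply: le_ball.
  by rewrite lef_pV2 ?posrE ?ltr0n// ler_nat.
- rewrite (_ : \bigcap_n _ = set0) ?measure0 ?lte_fin//.
  apply/seteqP; split => // x /= Gx.
  have [Ox _] := Gx 0%N Logic.I.
  have [r /= r0 rO] : nbhs_ball x O by apply/nbhs_ballP; exact: open_nbhs_nbhs.
  have [n nr] : exists n, (n.+1%:R^-1 : R) < r.
    have [n _ /(_ n (leqnn n)) nr] : \forall n \near \oo, (n.+1%:R^-1 : R) < r.
      exact: near_infty_natSinv_lt (PosNum r0).
    by exists n.
  have [_ [y Oy yx]] := Gx n Logic.I.
  apply: Oy; apply: rO; apply: ball_sym; apply: le_ball (ltW nr) _ _.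
  exact: interior_subset yx.
exists (~` G n); split; [exact: open_closedC| |by rewrite OG].
move=> x Gx; apply: contrapT => Ox; apply: Gx; exists x => //.
by apply: nbhs_singleton; apply: nbhs_interior; exact: nbhsx_ballx.
Qed.

(** Approximation from both sides at once makes the property stable under complements. *)
Definition closed_open_regular (R : realType) (X : pseudoPMetricType R)
  (mu : set X -> \bar R) (A : set X) := forall e : R, 0 < e ->
  exists C O : set X, [/\ closed C, open O, C `<=` A, A `<=` O &
    (mu (O `\` C) < e%:E)%E].

(** The regular sets form a sigma-algebra containing the open sets. *)
Lemma borel_closed_open_regular (R : realType) (X : pseudoPMetricType R)
    (mu : probability (@borel_type R X) R) (A : set (@borel_type R X)) :
  measurable A -> closed_open_regular mu A.
Proof.
apply: smallest_sub => [|O oO e e0]; last first.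
  by have [C [cC CO ltC]] := open_closed_approx mu oO e0; exists C, O; split.
split => [e e0|B rB e e0|B rB e e0].
- exists set0, set0; split => //; [exact: closed0|exact: open0|].
  by rewrite setD0 measure0 lte_fin.
- have [C [V [cC oO CB BO ltVC]]] := rB _ e0.
  exists (~` V), (~` C); split; [exact: open_closedC|exact: closed_openC| | |].
  + by rewrite setTD; exact: subsetC.
  + by rewrite setTD; exact: subsetC.
  + by rewrite setDE setCK setIC -setDE.
(* The errors sum to at most [e / 2]; halving keeps the final inequality strict. *)
have e20 : 0 < e / 2 by rewrite divr_gt0.
have /choice [C /choice [V CV]] : forall n, exists C O : set X,
    [/\ closed C, open O, C `<=` B n, B n `<=` O &
    (mu (O `\` C) < (e / 2 / (2 ^ n.+1)%:R)%:E)%E].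
  by move=> n; apply: rB; rewrite divr_gt0// ltr0n expn_gt0.
have oV : open (\bigcup_n V n) by apply: bigcup_open => n _; case: (CV n).
have cC m : closed (\bigcup_(n in `I_m) C n).
  by apply: closed_bigcup => // n _; case: (CV n).
have mVC n : measurable (V n `\` C n : set (@borel_type R X)).
  apply: measurableD; [apply: open_borel_measurable|
    apply: closed_borel_measurable]; by case: (CV n).
(* A countable union of closed sets need not be closed, so the inner union is truncated at a finite
   stage by continuity from above. *)
have [|||n nlt] := @nonincreasing_measure_lt _ _ _ mu
    (fun m => \bigcup_n V n `\` \bigcup_(n in `I_m) C n) e%:E.
- move=> m; apply: measurableD; first exact: open_borel_measurable.
  exact: closed_borel_measurable.
- move=> m n mn; apply/subsetPset; apply: setDS => x [i /= im Cx].
  by exists i => //=; exact: leq_trans mn.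
- apply: (@le_lt_trans _ _ (\sum_(0 <= n <oo) mu (V n `\` C n))%E).
    apply: measure_sigma_subadditive => //.
      apply: bigcapT_measurable => m.
      by apply: measurableD; [exact: open_borel_measurable|
        exact: closed_borel_measurable].
    move=> x /= VC; have [[n _ Vnx] _] := VC 0%N Logic.I.
    exists n => //; split=> // Cnx.
    by have [_] := VC n.+1 Logic.I; apply; exists n => /=.
  apply: (@le_lt_trans _ _ (e / 2)%:E); last by rewrite lte_fin; lra.
  apply: le_trans (epsilon_trick0 predT (ltW e20)).
  by apply: lee_nneseries => // n _; apply: ltW; case: (CV n).
exists (\bigcup_(i in `I_n) C i), (\bigcup_i V i); split => //.
- by move=> x [i _ Cx]; exists i => //; case: (CV i) => _ _ + _ _; exact.
- by move=> x [i _ Bx]; exists i => //; case: (CV i) => _ _ _ + _; exact.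
Qed.

(** * Upper limits, minimal subcovers and iterates *)

Lemma limn_esup_leD (R : realType) (u v : (\bar R)^nat) (c : R) :
  (forall n, u n <= v n + c%:E)%E -> (limn_esup u <= limn_esup v + c%:E)%E.
Proof.
move=> uv; rewrite -leeBlDr//; apply: le_ereal_inf_tmp => _ [V FV <-].
rewrite leeBlDr//; apply: (@le_trans _ _ (ereal_sup (u @` V))).
  by apply: ereal_inf_lbound; exists V.
apply: ge_ereal_sup => _ [n Vn <-]; apply: le_trans (uv n) _.
by rewrite leeD2r//; apply: ereal_sup_ubound; exists n.
Qed.

Lemma NcovP (R : realType) (X : pseudoPMetricType R) (I : finType)
    (U : I -> set X) : (forall x, exists i, U i x) ->
  exists2 J : {set I}, (forall x, exists2 i, i \in J & U i x) & #|J| = Ncov U.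
Proof.
move=> Ucov.
pose P m := `[< exists J : {set I},
  (forall x, exists2 j, j \in J & U j x) /\ #|J| = m >].
have exP : exists m, P m.
  exists #|[set: I]%SET|; apply/asboolP; exists [set: I]%SET; split => // x.
  by have [i Ui] := Ucov x; exists i; rewrite ?inE.
case: (ex_minnP exP) => m /asboolP Pm minm.
have [|[J [Jcov JN]] _] := @xgetPex _ 0%N [set m |
    (exists J : {set I}, (forall x, exists2 j, j \in J & U j x) /\ #|J| = m) /\
    (forall J : {set I}, (forall x, exists2 j, j \in J & U j x) ->
      (m <= #|J|)%N)]; last by exists J.
by exists m; split => // J Jcov; apply: minm; apply/asboolP; exists J.
Qed.

Lemma fiter_continuous (R : realType) (X : pseudoPMetricType R)
    (f : nat -> X -> X) (i n : nat) :
  (forall n, continuous (f n)) -> continuous (fiter f i n).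
Proof.
move=> cf; elim: n => [|n IH] x /=; first exact: cvg_id.
by apply: continuous_comp; [exact: IH|exact: cf].
Qed.

(** The sets with Borel preimage form a sigma-algebra containing the open sets. *)
Lemma continuous_borel_preimage (R : realType) (X : pseudoPMetricType R)
    (g : X -> X) (B : set (@borel_type R X)) :
  continuous g -> measurable B -> measurable (g @^-1` B : set (@borel_type R X)).
Proof.
move=> /continuousP cg; apply: (@smallest_sub _ _ _
    [set B | measurable (g @^-1` B : set (@borel_type R X))]).
  split => [|A mA|A mA] /=.
  - by rewrite preimage_set0.
  - by rewrite setTD preimage_setC; exact: measurableC.
  - by rewrite preimage_bigcup; exact: bigcupT_measurable.
by move=> O oO; apply: open_borel_measurable; exact: cg.
Qed.

Lemma fiter_invariant (R : realType) (X : pseudoPMetricType R)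
    (f : nat -> X -> X) (mu : set (@borel_type R X) -> \bar R) (i n : nat)
    (B : set (@borel_type R X)) :
  (forall n, continuous (f n)) ->
  (forall n (B : set (@borel_type R X)),
     measurable B -> mu (f n @^-1` B) = mu B) ->
  measurable B -> mu (fiter f i n @^-1` B) = mu B.
Proof.
move=> cf inv; elim: n B => // n IH B mB.
have mfB := continuous_borel_preimage (cf (i + n)%N) mB.
by rewrite -(inv (i + n)%N B mB) -(IH _ mfB).
Qed.

(** * The entropy bound at a finite time *)

Lemma Hmu_join_le (R : realType) (X : pseudoPMetricType R)
    (f : nat -> X -> X) (mu : probability (@borel_type R X) R)
    (a : nat -> nat) (k : nat) (xi B : 'I_k -> set X) (e : R) (n : nat) :
  (forall n, continuous (f n)) ->
  (forall n (B : set (@borel_type R X)),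
     measurable B -> mu (f n @^-1` B) = mu B) ->
  borel_partition xi ->
  (forall j, closed (B j)) -> (forall j, B j `<=` xi j) ->
  (forall j, (mu (xi j `\` B j) <= (e ^+ 2)%:E)%E) -> 0 <= e <= 1 ->
  Hmu mu (join_fam f a (n := n) xi) <=
    ln (Ncov (join_fam f a (n := n)
      (fun i => ~` \bigcup_(j in [set j | j != i]) B j)))%:R +
    n%:R * (3 * k.+1%:R * e).
Proof.
move=> cf inv [mxi dxi cxi] cB Bxi lexi e01.
set U := fun i => _.
have xi_inj x i j : xi i x -> xi j x -> i = j.
  move=> xix xjx; apply/eqP; apply: contrapT => /negP ij.
  by have : (xi i `&` xi j) x by []; rewrite dxi.
have /choice [c cP] : forall x, exists i, xi i x by [].
have Bc x i : B i x -> c x = i by move=> /Bxi; exact: xi_inj.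
pose z x : option 'I_k := if `[< B (c x) x >] then None else Some (c x).
have mB i : measurable (B i : set (@borel_type R X)).
  exact: closed_borel_measurable.
have zSome i : z @^-1` [set Some i] = xi i `\` B i.
  apply/seteqP; split => x /=; rewrite /z.
    by case: asboolP => // nB [ci]; rewrite -ci; split => //; exact: cP.
  by move=> [xix nB]; rewrite (xi_inj _ _ _ (cP x) xix); case: asboolP.
have mz : fin_measurable (z : borel_type -> _).
  apply: fin_measurable_fibers => -[i|].
    by rewrite zSome; exact: measurableD.
  rewrite (_ : z @^-1` [set None] = \bigcup_(i in [set: 'I_k]) B i).
    exact: fin_bigcup_measurable.
  apply/seteqP; split => x /=; rewrite /z.
    by case: asboolP => // ?; exists (c x).
  by move=> [i _ Bix]; rewrite (Bc _ _ Bix); case: asboolP.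
have mzi i : fin_measurable (z \o fiter f 0 (a i) : borel_type -> _).
  move=> S; apply: (@continuous_borel_preimage _ _ _ (z @^-1` S)) => //.
  exact: fiter_continuous.
have lawzi i t : law mu (z \o fiter f 0 (a i)) t = law mu z t.
  by rewrite /law -(fiter_invariant 0 (a i) cf inv (mz [set t])).
have Uc x i : U i x -> B (c x) x -> c x = i.
  move=> Uix Bx; apply/eqP; apply: contrapT => /negP ci.
  by apply: Uix; exists (c x).
(* This makes [U] a cover: the only [B j] that can contain [x] is the one with [j = c x]. *)
have xU x : U (c x) x.
  by move=> [j /= jc Bj]; move: jc; rewrite (Bc _ _ Bj) eqxx.
have oU i : open (U i).
  by apply: closed_openC; apply: closed_bigcup => //; exact: finite_finset.
have [J Jcov <-] : exists2 J : {set {ffun 'I_n -> 'I_k}},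
    (forall x, exists2 w, w \in J & join_fam f a U w x) &
    #|J| = Ncov (join_fam f a (n := n) U).
  apply: NcovP => x; exists [ffun i => c (fiter f 0 (a (i : 'I_n)) x)] => i.
  by rewrite ffunE; exact: xU.
have mU (w : {ffun 'I_n -> 'I_k}) :
    measurable (join_fam f a U w : set (@borel_type R X)).
  rewrite (_ : join_fam f a U w =
    \bigcap_(i in [set: 'I_n]) fiter f 0 (a i) @^-1` U (w i)).
    apply: fin_bigcap_measurable => // i _; apply: continuous_borel_preimage.
      exact: fiter_continuous.
    exact: open_borel_measurable.
  by apply/seteqP; split => x Ux i; [move=> _; exact: Ux|exact: Ux].
(* The choice of [w x] reads only the finite table of memberships of [x], so it is measurable. The
   default of [odflt] is never reached, since [J] indexes a subcover. *)
pose pickJ (v : {ffun {ffun 'I_n -> 'I_k} -> bool}) :=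
  odflt [ffun=> c point] [pick w in J | v w].
pose w (x : @borel_type R X) := pickJ [ffun w => `[< join_fam f a U w x >]].
have mw : fin_measurable w.
  apply: (fin_measurable_comp pickJ); apply: fin_measurable_ffun => v.
  exact: fin_measurable_asbool.
have wP x : w x \in J /\ join_fam f a U (w x) x.
  rewrite /w /pickJ; case: pickP => [v /andP[vJ]|].
    by rewrite ffunE => /asboolP.
  by have [v vJ Uv] := Jcov x => /(_ v); rewrite vJ ffunE asboolT.
(* The decoder trusts [y i] when it carries a name, and otherwise falls back on the subcover
   index. *)
pose psi (v : {ffun 'I_n -> 'I_k}) (y : {ffun 'I_n -> option 'I_k}) :=
  [ffun i => odflt (v i) (y i)].
have psiE x : psi (w x) [ffun i => (z \o fiter f 0 (a (i : 'I_n))) x] =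
    [ffun i => c (fiter f 0 (a (i : 'I_n)) x)].
  apply/ffunP => i; rewrite !ffunE /= /z; case: asboolP => //= Bx.
  by apply: esym; apply: (Uc _ _ _ Bx); exact: (wP x).2.
(* The cell of the join indexed by [v] is the fibre over [v] of the map sending [x] to its name. *)
have -> : Hmu mu (join_fam f a (n := n) xi) = entropy (law mu
    (fun x => psi (w x) [ffun i => (z \o fiter f 0 (a (i : 'I_n))) x])).
  rewrite /Hmu /entropy; congr (- _); apply: eq_bigr => v _.
  rewrite /law (_ : join_fam f a xi v = (fun x => psi (w x)
    [ffun i => (z \o fiter f 0 (a (i : 'I_n))) x]) @^-1` [set v])//.
  apply/seteqP; split => x; rewrite /preimage /= psiE.
    move=> xiv; apply/ffunP => i; rewrite ffunE.
    exact: xi_inj (cP _) (xiv i).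
  by move=> <- i; rewrite ffunE; exact: cP.
apply: le_trans (entropy_law_code psi mw mzi (fun x => (wP x).1) lawzi) _.
rewrite lerD2l ler_wpM2l//.
(* The factor [k.+1] counts the [k] names together with [None]. *)
rewrite (_ : k.+1 = #|{: option 'I_k}|); last by rewrite card_option card_ord.
apply: (entropy_concentrated (t0 := None)) => //.
- by move=> t; exact: law_ge0.
- exact: sum_law.
move=> [i _|//]; rewrite /law zSome -lee_fin fineK//.
by apply: fin_num_measure; exact: measurableD.
Qed.

(** * Passage to the upper limit and comparison of suprema *)

Theorem theorem3p7 (R : realType) (X : pseudoPMetricType R)
  (hX : hausdorff_space X) (cX : compact [set: X])
  (dX : @finite_covering_dim R X)
  (f : nat -> X -> X) (cf : forall n, continuous (f n))
  (mu : probability (@borel_type R X) R)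
  (inv : forall (n : nat) (B : set (@borel_type R X)),
           measurable B -> mu (f n @^-1` B) = mu B)
  (a : nat -> nat) (ha : {homo a : m n / (m < n)%N}) :
  (hmu mu f a <= htop f a)%E.
Proof.
apply: ge_ereal_sup => _ [k [xi [xiP ->]]].
apply/lee_addgt0Pr => d d0.
have [mxi dxi cxi] := xiP.
(* Chosen so that the per-step error [3 * k.+1%:R * e] is at most [d], with [e <= 1]. *)
pose e : R := Num.min 1 (d / (3 * k.+1%:R)).
have k0 : 0 < 3 * k.+1%:R :> R by rewrite mulr_gt0// ltr0n.
have e0 : 0 < e by rewrite lt_min ltr01 divr_gt0.
have ed : 3 * k.+1%:R * e <= d by rewrite mulrC -ler_pdivlMr// ge_min lexx orbT.
have e01 : 0 <= e <= 1 by rewrite ltW//= ge_min lexx.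
have /choice [B BP] : forall j, exists C : set X,
    [/\ closed C, C `<=` xi j & (mu (xi j `\` C) <= (e ^+ 2)%:E)%E].
  (* Only the closed set is kept; the open one bounds the mass, as [xi j]\[C] lies in [V]\[C]. *)
  move=> j; have [C [V [cC oV Cxi xiV ltVC]]] :=
    borel_closed_open_regular mu (mxi j) (exprn_gt0 2 e0).
  have mC := closed_borel_measurable cC; have mV := open_borel_measurable oV.
  exists C; split => //; apply: le_trans (ltW ltVC).
  apply: le_measure; rewrite ?inE; [exact: measurableD..|exact: setSD].
have cB j : closed (B j) by case: (BP j).
have Bxi j : B j `<=` xi j by case: (BP j).
pose U (i : 'I_k) := ~` \bigcup_(j in [set j | j != i]) B j.
have Ucover : open_cover U.
  split => [i|x].
    by apply: closed_openC; apply: closed_bigcup => //; exact: finite_finset.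
  have [i xix] := cxi x; exists i => -[j /= ji /Bxi xjx].
  by have : (xi j `&` xi i) x by []; rewrite dxi.
apply: (@le_trans _ _ (htop_cover f a U + d%:E)%E); last first.
  by rewrite leeD2r//; apply: ereal_sup_ubound; exists k, U.
apply: limn_esup_leD => n; rewrite -EFinD lee_fin.
(* At [n = 0] both quotients vanish, since the inverse of 0 is 0. *)
have [->|n0] := posnP n; first by rewrite invr0 !mulr0 add0r ltW.
rewrite ler_pdivrMr ?ltr0n// mulrDl divfK ?pnatr_eq0 -?lt0n//.
apply: le_trans (Hmu_join_le a n cf inv xiP cB Bxi _ e01) _.
  by move=> j; case: (BP j).
by rewrite lerD2l mulrC ler_wpM2r.
Qed.
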